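(* Let $n$ be a positive multiple of $4$, $n_0=n/4$, $c_e\ge0$, $0<c_l\le c_L$. Let $x^*\in\mathcal C^n$ and $f\in\mathcal{BL}[c_l,c_L,c_e]$, and suppose the observed random symmetric matrix $A$ satisfies $A_{ii}=0$ and $A_{ij}=f(x_i^*,x_j^* )+E_{ij}$ for $i<j$, where the centered independent variables $(E_{ij})_{i<j}$ satisfy the subGaussian(1) condition. Let $S\subset\{1,\dots,n\}$ be of cardinality $n_0$, and let $$\hat x^{(1)}_S\in\arg\min_{x_S\in\Pi_{n_0}}\ \sum_{i,j\in S}A_{ij}\,d(x_i,x_j).$$ Then there exists a constant $C_{lLe}$ depending only on $c_l,c_L,c_e$ such that, with probability higher than $1-1/n^2$, $$\min_{Q\in\mathcal O}d_1(\hat x^{(1)}_S,Qx^*_S)\le C_{lLe}\left(n\,d_\infty(x^*_S,\Pi_{n_0})+\sqrt{n\log n}\right).$$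
   Context: $\mathcal C$ is the unit circle in $\mathbb R^2$, identified with unit complex numbers; $x\in\mathcal C$ has argument $\underline x\in[0,2\pi)$; $d(x,y)=|\underline x-\underline y|\wedge(2\pi-|\underline x-\underline y|)$ is the geodesic distance. For tuples $x,y$ of points of $\mathcal C$ indexed by the same set, $d_\infty(x,y)=\max_i d(x_i,y_i)$ and $d_1(x,y)=\sum_id(x_i,y_i)$; $x_S=(x_i)_{i\in S}$. $\Pi_k$ is the set of $k$-tuples (indexed by a set of cardinality $k$) that list each element of $\{e^{\iota 2\pi j/k}:0\le j\le k-1\}$ exactly once; $d_\infty(x,\Pi_k)=\min_{y\in\Pi_k}d_\infty(x,y)$. $\mathcal O$ is the orthogonal group of $\mathbb R^2$, acting coordinatewise on tuples. $\mathcal{BL}[c_l,c_L,c_e]$ is the set of symmetric functions $f:\mathcal C\times\mathcal C\to[0,1]$ such that for all $x,y,y'\in\mathcal C$, with $\varepsilon_n=c_e\sqrt{\log(n)/n}$: $|f(x,y)-f(x,y')|\le c_Ld(y,y')+\varepsilon_n$; and $f(x,y')-f(x,y)\ge c_l(d(x,y)-d(x,y'))-\varepsilon_n$ whenever $d(x,y)\ge d(x,y')$. SubGaussian(1) condition: for every $B\in\mathbb R^{n\times n}$ and $t\ge0$, $\mathbb P\big[\sum_{i<j}B_{ij}E_{ij}>t\sqrt{\sum_{i<j}B_{ij}^2}\big]\le e^{-t^2/2}$. *)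

(* Defs.v *)
From HB Require Import structures.
From mathcomp Require Import all_boot all_order all_algebra.
From mathcomp Require Import ring lra.
From mathcomp Require Import all_classical all_reals all_analysis.

Set Implicit Arguments.
Unset Strict Implicit.
Unset Printing Implicit Defensive.

Import Order.TTheory GRing.Theory Num.Theory.
Import numFieldNormedType.Exports.

Local Open Scope classical_set_scope.
Local Open Scope ring_scope.

Definition circle (R : realType) : Type :=
  {x : 'cV[R]_2 | x 0 0 ^+ 2 + x 1 0 ^+ 2 == 1}.

Definition orthogonal_group (R : realType) : Type :=
  {Q : 'M[R]_2 | Q *m Q^T == 1%:M}.

(* [acos] takes values in [0, pi], so the lower half-circle is reflected;
   see [arg_ge0], [arg_lt2pi], [cos_arg] and [sin_arg] below. *)
Definition arg (R : realType) (x : circle R) : R :=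
  if 0 <= val x 1 0 then acos (val x 0 0) else 2 * pi - acos (val x 0 0).

Definition dcirc (R : realType) (x y : circle R) : R :=
  let t := `|arg x - arg y| in Num.min t (2 * pi - t).

(* Tuples of points of the circle indexed by I are functions I -> circle R.
   The default value 0 of the maximum is harmless since [dcirc] is
   nonnegative. *)
Definition dinf (R : realType) (I : finType) (x y : I -> circle R) : R :=
  \big[Num.max/0]_i dcirc (x i) (y i).

Definition d1 (R : realType) (I : finType) (x y : I -> circle R) : R :=
  \sum_i dcirc (x i) (y i).

(* The unit complex number e^{i t}. *)
Lemma cis_subproof (R : realType) (t : R) :
  let x : 'cV[R]_2 := \col_i (if i == 0 then cos t else sin t) in
  x 0 0 ^+ 2 + x 1 0 ^+ 2 == 1.
Proof. by rewrite /= !mxE /= cos2Dsin2. Qed.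

Definition cis (R : realType) (t : R) : circle R :=
  exist _ (\col_i (if i == 0 then cos t else sin t)) (cis_subproof t).

Definition unity_root (R : realType) (k : nat) (j : 'I_k) : circle R :=
  cis (2 * pi * j%:R / k%:R).

(* Empty unless #|I| = k. *)
Definition Pi (R : realType) (I : finType) (k : nat) : set (I -> circle R) :=
  [set x | (forall i, exists j : 'I_k, x i = unity_root R j) /\
           (forall j : 'I_k, exists! i, x i = unity_root R j)].
Arguments Pi R I k : clear implicits.

(* The infimum is a minimum: see [dinf_Pi_attained]. *)
Definition dinf_Pi (R : realType) (I : finType) (k : nat)
    (x : I -> circle R) : R :=
  inf [set dinf x y | y in Pi R I k].

Lemma act_subproof (R : realType) (Q : orthogonal_group R) (x : circle R) :
  let y := val Q *m val x in y 0 0 ^+ 2 + y 1 0 ^+ 2 == 1.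
Proof.
case: Q x => Q /= /eqP /mulmx1C QQ [x /= /eqP x1].
have E (v : 'cV[R]_2) : v 0 0 ^+ 2 + v 1 0 ^+ 2 = (v^T *m v) 0 0.
  rewrite mxE big_ord_recl big_ord1 !mxE !expr2.
  by have -> : lift ord0 ord0 = 1 :> 'I_2 by apply/val_inj.
by apply/eqP; rewrite E trmx_mul mulmxA -(mulmxA _ Q^T) QQ mulmx1 -E.
Qed.

Definition act (R : realType) (Q : orthogonal_group R) (x : circle R) : circle R :=
  exist _ (val Q *m val x) (act_subproof Q x).

Definition act_tuple (R : realType) (I : Type) (Q : orthogonal_group R)
    (x : I -> circle R) : I -> circle R :=
  fun i => act Q (x i).

Definition restr (R : realType) (n : nat) (S : {set 'I_n})
    (x : 'I_n -> circle R) : {i : 'I_n | i \in S} -> circle R :=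
  fun i => x (val i).

Definition epsn (R : realType) (ce : R) (n : nat) : R :=
  ce * Num.sqrt (ln n%:R / n%:R).

Definition biLipschitz (R : realType) (cl cL ce : R) (n : nat)
    (f : circle R -> circle R -> R) : Prop :=
  [/\ forall x y, f x y = f y x,
      forall x y, 0 <= f x y <= 1,
      forall x y y',
        `|f x y - f x y'| <= cL * dcirc y y' + epsn ce n
    & forall x y y', dcirc x y' <= dcirc x y ->
        cl * (dcirc x y - dcirc x y') - epsn ce n <= f x y' - f x y].

Definition mutually_independent (d : measure_display) (T : measurableType d)
    (R : realType) (P : probability T R) (I : finType) (D : {set I})
    (X : I -> {RV P >-> R}) : Prop :=
  forall (J : {set I}) (B : I -> set R), J \subset D ->
    (forall i, measurable (B i)) ->
    P (\bigcap_(i in [set` J]) (X i @^-1` B i)) =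
    (\prod_(i in J) P (X i @^-1` B i))%E.

Definition centered (d : measure_display) (T : measurableType d)
    (R : realType) (P : probability T R) (X : {RV P >-> R}) : Prop :=
  P.-integrable setT (EFin \o X) /\ ('E_P[X] = 0)%E.

Definition subGaussian1 (d : measure_display) (T : measurableType d)
    (R : realType) (P : probability T R) (n : nat)
    (E : 'I_n -> 'I_n -> {RV P >-> R}) : Prop :=
  forall (B : 'M[R]_n) (t : R), 0 <= t ->
    (P [set w | (\sum_(i < n) \sum_(j < n | (i < j)%N) B i j * E i j w >
                 t * Num.sqrt (\sum_(i < n) \sum_(j < n | (i < j)%N)
                                 B i j ^+ 2))%R]
     <= (expR (- (t ^+ 2) / 2))%:E)%E.

(* Only the entries E i j with i < j of the noise are used. *)
Definition observation (d : measure_display) (T : measurableType d)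
    (R : realType) (P : probability T R) (n : nat)
    (xs : 'I_n -> circle R) (f : circle R -> circle R -> R)
    (E : 'I_n -> 'I_n -> {RV P >-> R}) (A : T -> 'M[R]_n) : Prop :=
  forall w, [/\ (A w)^T = A w,
    forall i, A w i i = 0
  & forall i j : 'I_n, (i < j)%N -> A w i j = f (xs i) (xs j) + E i j w].

Definition objective (R : realType) (n : nat) (S : {set 'I_n}) (A : 'M[R]_n)
    (x : {i : 'I_n | i \in S} -> circle R) : R :=
  \sum_i \sum_j A (val i) (val j) * dcirc (x i) (x j).

Definition argmin (R : realType) (X : Type) (D : set X) (g : X -> R) : set X :=
  [set x | D x /\ forall y, D y -> g x <= g y].

Section Facts.
Variable R : realType.
Implicit Types x : circle R.

Lemma circle_fst_itv x : -1 <= val x 0 0 <= 1.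
Proof.
case: x => v /= /eqP v1; have := sqr_ge0 (v 1 0) => ?.
by apply/andP; split; nra.
Qed.

Lemma acos_lt_pi x : val x 1 0 != 0 -> 0 < acos (val x 0 0) < pi.
Proof.
move=> x1; have /andP[h1 h2] := circle_fst_itv x.
have x1sq : 0 < val x 1 0 ^+ 2 by rewrite exprn_even_gt0.
have /eqP xE : val x 0 0 ^+ 2 + val x 1 0 ^+ 2 == 1 by case: (x).
by rewrite acos_gt0 ?acos_ltpi //; apply/andP; split => //; nra.
Qed.

Lemma arg_ge0 x : 0 <= arg x.
Proof.
rewrite /arg; case: ifP => _; first exact/acos_ge0/circle_fst_itv.
by have := acos_lepi (circle_fst_itv x); have := pi_gt0 R; lra.
Qed.

Lemma arg_lt2pi x : arg x < 2 * pi.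
Proof.
rewrite /arg; case: ifPn => [_|].
  by have := acos_lepi (circle_fst_itv x); have := pi_gt0 R; lra.
by rewrite -ltNge => /lt_eqF/negbT/acos_lt_pi/andP[]; lra.
Qed.

Lemma cos_arg x : cos (arg x) = val x 0 0.
Proof.
have h := circle_fst_itv x; rewrite /arg; case: ifP => _.
  by rewrite acosK // in_itv.
by rewrite addrC mulr_natl cosD2pi cosN acosK // in_itv.
Qed.

Lemma sin_arg x : sin (arg x) = val x 1 0.
Proof.
have h := circle_fst_itv x.
have /eqP xE : val x 0 0 ^+ 2 + val x 1 0 ^+ 2 == 1 by case: (x).
have sE : Num.sqrt (1 - val x 0 0 ^+ 2) = `|val x 1 0|.
  by rewrite -sqrtr_sqr; congr Num.sqrt; lra.
rewrite /arg; case: ifPn => [x1|]; first by rewrite sin_acos // sE ger0_norm.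
rewrite -ltNge => x1.
by rewrite addrC mulr_natl sinD2pi sinN sin_acos // sE ltr0_norm // opprK.
Qed.

Lemma dcirc_ge0 (x y : circle R) : 0 <= dcirc x y.
Proof.
rewrite /dcirc le_min normr_ge0 subr_ge0 ler_norml.
have := arg_ge0 x; have := arg_ge0 y.
have := arg_lt2pi x; have := arg_lt2pi y.
by move=> ? ? ? ?; apply/andP; split; lra.
Qed.

Lemma dinf_ge0 (I : finType) (x y : I -> circle R) : 0 <= dinf x y.
Proof. exact: bigmax_ge_id. Qed.

Lemma cis_inj (s t : R) : 0 <= s < 2 * pi -> 0 <= t < 2 * pi ->
  cis s = cis t -> s = t.
Proof.
move=> hs ht /(congr1 val)/matrixP st.
have := st 0 0; have := st 1 0; rewrite !mxE /= => sE cE.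
have c1 : cos (s - t) = 1.
  by rewrite cosB sE cE -!expr2 cos2Dsin2.
have halfE : s - t = ((s - t) / 2) *+ 2 by rewrite -mulr_natr divfK.
have s0 : sin ((s - t) / 2) = 0.
  apply/eqP; rewrite -sqrf_eq0 sin2cos2 subr_eq0 eq_sym; apply/eqP.
  by move: c1; rewrite {1}halfE cos_mulr2n; lra.
case: (ltrgtP s t) => // st'.
- have := @sin_gt0_pi R ((t - s) / 2) _.
  rewrite -opprB mulNr sinN s0 oppr0 ltxx => h; suff : false by [].
  by apply: h; apply/andP; split; lra.
- have := @sin_gt0_pi R ((s - t) / 2) _.
  rewrite s0 ltxx => h; suff : false by [].
  by apply: h; apply/andP; split; lra.
Qed.

Lemma unity_root_inj (k : nat) : injective (@unity_root R k).
Proof.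
move=> i j /cis_inj; have := pi_gt0 R => pi0.
have k0 : (0 < k)%N by case: k i {j} => [[]|].
have kR : 0 < k%:R :> R by rewrite ltr0n.
have b (l : 'I_k) : 0 <= 2 * (pi : R) * l%:R / k%:R < 2 * (pi : R).
  have pi2 : 0 < 2 * (pi : R) by lra.
  apply/andP; split; last first.
    have lk : (l%:R : R) < k%:R by rewrite ltr_nat.
    by rewrite ltr_pdivrMr // ltr_pM2l.
  apply: divr_ge0; last exact: ltW.
  by apply: mulr_ge0; [exact: ltW | exact: ler0n].
move=> /(_ (b i) (b j)) /(mulIf (invr_neq0 (lt0r_neq0 kR))).
have /mulfI h : 2 * pi != 0 :> R by rewrite mulf_neq0 ?gt_eqF.
by move/h/eqP; rewrite eqr_nat => /eqP/val_inj.
Qed.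

Lemma Pi_neq0 (I : finType) (k : nat) : #|I| = k -> Pi R I k !=set0.
Proof.
move=> <-; exists (fun i => unity_root R (enum_rank i)); split=> [i|j].
  by exists (enum_rank i).
exists (enum_val j); split; first by rewrite enum_valK.
by move=> i /unity_root_inj <-; rewrite enum_rankK.
Qed.

Lemma dinf_Pi_attained (I : finType) (k : nat) (x : I -> circle R) :
  Pi R I k !=set0 ->
  exists2 y, Pi R I k y &
    dinf_Pi k x = dinf x y /\ forall z, Pi R I k z -> dinf x y <= dinf x z.
Proof.
have fP y : Pi R I k y ->
    exists s : {ffun I -> 'I_k}, y = (fun i => unity_root R (s i)).
  case=> /boolp.choice[s sE] _; exists [ffun i => s i].
  by apply/funext => i; rewrite ffunE sE.
case=> y0 Py0; have [s0 y0E] := fP _ Py0.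
pose g (s : {ffun I -> 'I_k}) i := unity_root R (s i).
pose p : pred {ffun I -> 'I_k} := fun s => `[< Pi R I k (g s) >].
have Ps0 : p s0 by apply/asboolP; rewrite /g -y0E.
case: (@Order.TotalTheory.arg_minP _ _ _ s0 p (fun s => dinf x (g s)) Ps0).
move=> s /asboolP Ps smin.
have ymin z : Pi R I k z -> dinf x (g s) <= dinf x z.
  move=> Pz; have [t zE] := fP _ Pz; rewrite zE.
  by apply: smin; apply/asboolP; rewrite /g -zE.
exists (g s) => //; split => //; apply/le_anti/andP; split.
  apply: ge_inf; last by exists (g s).
  by exists 0 => _ [z _ <-]; exact: dinf_ge0.
apply: lb_le_inf; first by exists (dinf x (g s)), (g s).
by move=> _ [z Pz <-]; exact: ymin.
Qed.

End Facts.

(* Main.v *)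
Require Import Defs.
From mathcomp Require Import all_boot all_order all_algebra.
From mathcomp Require Import ring lra zify.
From mathcomp Require Import all_classical all_reals all_analysis.
From mathcomp Require Import measurable_realfun.

(* Let N = n/4, let y in Pi_N be closest to x*_S, and put
   D_ij = d(xhat_i, xhat_j) - d(y_i, y_j), with X the Frobenius norm of D.
   Optimality of xhat bounds sum f(x*_i, x*_j) D_ij by the noise term, which a
   union bound over the at most N^N elements of Pi_N controls by
   sqrt(n log n) X.  Conversely, the i-th rows of d(xhat, xhat) and d(y, y) are
   permutations of each other, so subtracting the linear part of f and applying
   a rearrangement inequality to the rest gives
   sum f(y_i, y_j) D_ij >= (c_l/2) X^2 - eps sum |D_ij|.
   Together, X <= C (n d_inf(x*_S, Pi_N) + sqrt(n log n)).
   Finally two anchors i0, i1 with y_i0, y_i1 roughly orthogonal determine an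
   orthogonal Q such that d(xhat_j, Q y_j) is at most a constant times
   |D_i0j| + |D_i1j| + |D_i0i1| for every j; averaging over the anchors gives
   d_1(xhat, Q y) <= 67 X. *)

Set Implicit Arguments.
Unset Strict Implicit.
Unset Printing Implicit Defensive.

Import Order.TTheory GRing.Theory Num.Theory.
Import numFieldNormedType.Exports.

Local Open Scope classical_set_scope.
Local Open Scope ring_scope.

Lemma le_of_eq (disp : Order.disp_t) (T : porderType disp) (a b : T) :
  a = b -> (a <= b)%O.
Proof. by move=> ->. Qed.

(** * Geometry of the geodesic distance and of the orthogonal action on angles *)

Section Circle.
Variable R : realType.
Implicit Types x y z : circle R.

Lemma acos_cos_small (u : R) : `|u| <= pi -> acos (cos u) = `|u|.
Proof.
move=> hu; have <- : cos `|u| = cos u by rewrite cos_norm.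
by rewrite cosK // in_itv /= normr_ge0.
Qed.

Lemma acos_cos_large (u : R) :
  pi <= `|u| <= 2 * pi -> acos (cos u) = 2 * pi - `|u|.
Proof.
move=> /andP[h1 h2]; have <- : cos `|u| = cos u by rewrite cos_norm.
have -> : cos `|u| = cos (2 * pi - `|u|).
  by rewrite addrC mulr_natl cosD2pi cosN.
by rewrite cosK // in_itv /=; apply/andP; split; lra.
Qed.

Lemma acos_cos_le (u : R) : acos (cos u) <= `|u|.
Proof.
have [hu|hu] := leP `|u| pi; first by rewrite acos_cos_small.
apply/ltW/(le_lt_trans _ hu)/acos_lepi.
by rewrite cos_geN1 cos_le1.
Qed.

Definition dot x y : R := val x 0 0 * val y 0 0 + val x 1 0 * val y 1 0.

(** Two arguments differ by less than 2 pi, and on that range [acos] of [cos] folds the difference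
    exactly as the minimum in [dcirc] does. This form has no cut at angle 0 and makes invariance
    under the orthogonal group visible. *)
Lemma dcirc_acos x y : dcirc x y = acos (dot x y).
Proof.
have -> : dot x y = cos (arg x - arg y).
  by rewrite cosB !cos_arg !sin_arg.
have := arg_ge0 x; have := arg_ge0 y; have := arg_lt2pi x; have := arg_lt2pi y.
move=> hy hx y0 x0; have b : `|arg x - arg y| <= 2 * pi.
  by rewrite ler_norml; apply/andP; split; lra.
rewrite /dcirc; have [hu|hu] := leP `|arg x - arg y| pi.
  by rewrite acos_cos_small // min_l //; lra.
by rewrite acos_cos_large ?min_r //; lra.
Qed.

Lemma ord2P (i : 'I_2) : i = 0 \/ i = 1.
Proof. by case: i => [[|[|]]] //= h; [left | right]; apply/val_inj. Qed.

Lemma cis_arg x : cis (arg x) = x.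
Proof.
apply/val_inj/matrixP => i j; rewrite ord1 !mxE /= cos_arg sin_arg.
by case: (ord2P i) => ->.
Qed.

Lemma dcirc_cis (s t : R) : dcirc (cis s) (cis t) = acos (cos (s - t)).
Proof. by rewrite dcirc_acos /dot !mxE /= cosB. Qed.

Lemma dcirc_cis_le (s t : R) : dcirc (cis s) (cis t) <= `|s - t|.
Proof. by rewrite dcirc_cis acos_cos_le. Qed.

Lemma dcircC x y : dcirc x y = dcirc y x.
Proof. by rewrite /dcirc distrC. Qed.

Lemma dcircxx x : dcirc x x = 0.
Proof. by rewrite -[x]cis_arg dcirc_cis subrr cos0 acos1. Qed.

Lemma dcirc_le_pi x y : dcirc x y <= pi.
Proof.
rewrite -[x]cis_arg -[y]cis_arg dcirc_cis acos_lepi //.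
by rewrite cos_geN1 cos_le1.
Qed.

Lemma cisD2pi (t : R) : cis (t + 2 * pi) = cis t.
Proof.
by apply/val_inj/matrixP => i j; rewrite !mxE mulr_natl cosD2pi sinD2pi.
Qed.

(** A signed angle u with modulus equal to the distance: it turns statements on the circle into
    inequalities between reals, without wraparound. *)
Lemma dcirc_lift (t : R) x :
  exists2 u, x = cis (t + u) & `|u| = dcirc (cis t) x.
Proof.
have E u : x = cis (t + u) -> `|u| <= pi -> 
    exists2 u, x = cis (t + u) & `|u| = dcirc (cis t) x.
  move=> xE hu; exists u => //; rewrite xE dcirc_cis -acos_cos_small //.
  by rewrite -cosN; congr (acos (cos _)); lra.
pose a := arg (cis t); have ta : forall u, cis (t + u) = cis (a + u).
  move=> u; apply/val_inj/matrixP => i j; rewrite !mxE !cosD !sinD.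
  by rewrite cos_arg sin_arg !mxE.
have := arg_ge0 x; have := arg_ge0 (cis t).
have := arg_lt2pi x; have := arg_lt2pi (cis t); rewrite -/a => ha hx a0 x0.
(* The difference lies strictly between - 2 pi and 2 pi, so a shift by 2 pi, 0 or - 2 pi brings it
   into [- pi, pi]. *)
have [h1|h1] := ltP pi (arg x - a).
  apply: (E (arg x - a - 2 * pi)); last by rewrite ler_norml; lra.
  rewrite ta -cisD2pi -[LHS]cis_arg; congr cis; lra.
have [h2|h2] := ltP (arg x - a) (- pi).
  apply: (E (arg x - a + 2 * pi)); last by rewrite ler_norml; lra.
  rewrite ta -[LHS]cis_arg -cisD2pi; congr cis; lra.
apply: (E (arg x - a)); last by rewrite ler_norml; lra.
by rewrite ta -[LHS]cis_arg; congr cis; lra.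
Qed.

Lemma dcirc_triangle y x z : dcirc x z <= dcirc x y + dcirc y z.
Proof.
have [u xE hu] := dcirc_lift (arg y) x; have [v zE hv] := dcirc_lift (arg y) z.
rewrite cis_arg in hu hv; rewrite -hv (dcircC x y) -hu {1}xE {1}zE.
apply: (le_trans (dcirc_cis_le _ _)).
have -> : arg y + u - (arg y + v) = u - v by lra.
exact: ler_normB.
Qed.

Lemma dcirc_dist x x' y y' :
  `|dcirc x y - dcirc x' y'| <= dcirc x x' + dcirc y y'.
Proof.
have := dcirc_triangle x' x y; have := dcirc_triangle y' x' y.
have := dcirc_triangle x x' y'; have := dcirc_triangle y x y'.
by rewrite (dcircC x' x) (dcircC y' y) ler_norml; move=> *; apply/andP; split; lra.
Qed.

Lemma dcirc_act (Q : orthogonal_group R) x y :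
  dcirc (act Q x) (act Q y) = dcirc x y.
Proof.
rewrite !dcirc_acos; congr acos.
have E a b : dot a b = ((val a)^T *m val b) 0 0.
  rewrite mxE big_ord_recl big_ord1 !mxE.
  by have -> : lift ord0 ord0 = 1 :> 'I_2 by apply/val_inj.
rewrite !E /= trmx_mul mulmxA -(mulmxA _ _ (val Q)).
by case: Q => Q /= /eqP /mulmx1C ->; rewrite mulmx1.
Qed.

(* e = 1 gives the rotations, e = -1 the reflections. *)
Lemma orthogonal_angle (a e : R) : e ^+ 2 = 1 ->
  exists Q : orthogonal_group R, forall t, act Q (cis t) = cis (a + e * t).
Proof.
move=> e1.
pose Q : 'M[R]_2 := \matrix_(i, j)
  if j == 0 then (if i == 0 then cos a else sin a)
  else e * (if i == 0 then - sin a else cos a).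
have c1 := cos2sin2 a.
have QQ : Q *m Q^T == 1%:M.
  apply/eqP/matrixP => i j; rewrite mxE big_ord_recl big_ord1 !mxE /=.
  by case: (ord2P i) (ord2P j) => -> [->|->] /=; ring: e1 c1.
exists (exist _ Q QQ) => t; apply/val_inj/matrixP => i j.
have e2 : e = 1 \/ e = -1.
  have : (e == 1) || (e == -1) by rewrite -eqf_sqr e1 expr1n.
  by case/orP => /eqP; [left | right].
rewrite mxE big_ord_recl big_ord1 !mxE /= cosD sinD.
have -> : cos (e * t) = cos t by case: e2 => ->; rewrite ?mul1r ?mulN1r ?cosN.
have -> : sin (e * t) = e * sin t by case: e2 => ->; rewrite ?mul1r ?mulN1r ?sinN.
by case: (ord2P i) => -> /=; ring.
Qed.

(* The two distances to ph differ by
   2 min(|th|, pi - |th|, |ph|, pi - |ph|), so an anchor ph away from the axis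
   tells th from its mirror image - th. *)
Lemma mirror_sep (th ph : R) : `|th| <= pi -> pi / 4 <= `|ph| <= 3 * pi / 4 ->
  acos (cos (2 * th)) <= 2 * `|acos (cos (th + ph)) - acos (cos (th - ph))|.
Proof.
wlog th0 : th / 0 <= th.
  move=> H hth hph; have [t0|t0] := leP 0 th; first exact: H.
  have := H (- th) _ _ hph; rewrite oppr_ge0 (ltW t0) normrN => /(_ isT hth).
  have -> : 2 * - th = - (2 * th) by lra.
  have -> : - th + ph = - (th - ph) by lra.
  have -> : - th - ph = - (th + ph) by lra.
  by rewrite !cosN distrC.
wlog ph0 : ph / 0 <= ph.
  move=> H hth hph; have [t0|t0] := leP 0 ph; first exact: H.
  have := H (- ph); rewrite oppr_ge0 (ltW t0) normrN => /(_ isT hth hph).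
  by rewrite opprK distrC.
rewrite (ger0_norm th0) (ger0_norm ph0) => hth /andP[h1 h2].
(* For nonnegative angles in these ranges every arc cosine is piecewise linear, which leaves
   finitely many linear cases. *)
have -> : acos (cos (th - ph)) = `|th - ph|.
  by rewrite acos_cos_small // ler_norml; apply/andP; split; lra.
have -> : acos (cos (th + ph)) = Num.min (th + ph) (2 * pi - (th + ph)).
  have [?|?] := leP (th + ph) pi.
    by rewrite acos_cos_small ger0_norm ?min_l //; lra.
  by rewrite acos_cos_large ger0_norm ?min_r //; lra.
have -> : acos (cos (2 * th)) = Num.min (2 * th) (2 * pi - (2 * th)).
  have [?|?] := leP (2 * th) pi.
    by rewrite acos_cos_small ger0_norm ?min_l //; lra.
  by rewrite acos_cos_large ger0_norm ?min_r //; lra.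
apply: (@le_trans _ _
  (2 * (Num.min (th + ph) (2 * pi - (th + ph)) - `|th - ph|))); last first.
  by rewrite ler_pM2l ?ler_norm.
case: (ger0P (th - ph)) => h; case: (leP (th + ph)) => h';
  by case: (leP (2 * th)) => h''; lra.
Qed.

End Circle.

(** * Aligning two tuples by an orthogonal map built from two anchors *)

Section Alignment.
Variables (R : realType) (I : finType).
Implicit Types x y : I -> circle R.

Definition dist_diff x y (i j : I) : R :=
  dcirc (x i) (x j) - dcirc (y i) (y j).

(** Q sends [y i0] to [x i0], with the orientation that puts the image of [y i1] on the same side as
    [x i1]. The distance to [x i0] then locates [x j] up to the reflection fixing [x i0], and the
    second anchor decides between the two candidates. *)
Lemma align_anchors x y i0 i1 :
  pi / 4 <= dcirc (y i0) (y i1) <= 3 * pi / 4 ->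
  exists Q : orthogonal_group R, forall j,
    dcirc (x j) (act Q (y j)) <= 3 * `|dist_diff x y i0 j| +
      2 * `|dist_diff x y i1 j| + 2 * `|dist_diff x y i0 i1|.
Proof.
set s0 := arg (x i0); set t0 := arg (y i0) => hw.
have [v yi1 hv] := dcirc_lift t0 (y i1); have [u xi1 hu] := dcirc_lift s0 (x i1).
rewrite !cis_arg in hv hu.
(* The sign e gives e v the sign of u; it decides between rotation and reflection. *)
have [e e1 he] : exists2 e : R, e ^+ 2 = 1 & `|u - e * v| = `| `|u| - `|v| |.
  case: (ger0P u) => hu0; case: (ger0P v) => hv0.
  - by exists 1; rewrite ?expr1n ?mul1r.
  - by exists (- 1); rewrite ?sqrrN ?expr1n ?mulN1r.
  - by exists (- 1); rewrite ?sqrrN ?expr1n // mulN1r -normrN; congr `| _ |; lra.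
  - by exists 1; rewrite ?expr1n // mul1r -normrN; congr `| _ |; lra.
have ev : `|e * v| = `|v|.
  have : `|e| ^+ 2 = 1 by rewrite real_normK ?num_real.
  by move/eqP; rewrite sqrp_eq1 // normrM => /eqP ->; rewrite mul1r.
have [Q hQ] := orthogonal_angle (s0 - e * t0) e1.
exists Q => j; set D0 := `|dist_diff x y i0 j|; set D1 := `|dist_diff x y i1 j|.
set D01 := `|dist_diff x y i0 i1|.
have Qy0 : act Q (y i0) = cis s0 by rewrite -[y i0]cis_arg hQ /t0; congr cis; ring.
have Qy1 : act Q (y i1) = cis (s0 + e * v) by rewrite yi1 hQ; congr cis; ring.
have D01E : dcirc (x i1) (act Q (y i1)) <= D01.
  rewrite xi1 Qy1 (le_trans (dcirc_cis_le _ _)) // /D01 /dist_diff -hu -hv -he.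
  by apply: le_of_eq; congr `| _ |; lra.
set z := act Q (y j).
have [th zE hth] := dcirc_lift s0 z; have [ps xE hps] := dcirc_lift s0 (x j).
rewrite -{1}Qy0 dcirc_act in hth; rewrite cis_arg in hps.
have D0E : D0 = `| `|ps| - `|th| | by rewrite /D0 /dist_diff hps hth.
have D0_ge0 : 0 <= D0 := normr_ge0 _. have D1_ge0 : 0 <= D1 := normr_ge0 _.
have D01_ge0 : 0 <= D01 := normr_ge0 _.
have [same|opp] : `|ps - th| <= D0 \/ `|ps + th| <= D0.
  rewrite D0E; case: (ger0P ps) => h1; case: (ger0P th) => h2.
  - by left.
  - by right; rewrite opprK.
  - by right; rewrite -[X in X <= _]normrN; apply: le_of_eq; congr `| _ |; lra.
  - by left; rewrite -[X in X <= _]normrN; apply: le_of_eq; congr `| _ |; lra.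
  have : dcirc (x j) z <= `|ps - th|.
    rewrite xE zE (le_trans (dcirc_cis_le _ _)) //.
    by apply: le_of_eq; congr `| _ |; lra.
  by lra.
(* Here [x j] is close to the mirror image z' of z, so z and z' are at nearly equal distances from
   the image of [y i1]. That image is away from the axis, so [mirror_sep] forces z and z' to be
   close as well. *)
pose z' := cis (s0 - th).
have xz' : dcirc (x j) z' <= D0.
  apply: le_trans opp; rewrite xE /z' (le_trans (dcirc_cis_le _ _)) //.
  by apply: le_of_eq; congr `| _ |; lra.
have sep : dcirc z' z <= 2 * `|dcirc z' (act Q (y i1)) - dcirc z (act Q (y i1))|.
  have := @mirror_sep R th (e * v).
  rewrite ev hv hth => /(_ (dcirc_le_pi _ _) hw).
  rewrite zE /z' Qy1 !dcirc_cis.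
  have -> : s0 - th - (s0 + th) = - (2 * th) by lra.
  have -> : s0 - th - (s0 + e * v) = - (th + e * v) by lra.
  have -> : s0 + th - (s0 + e * v) = th - e * v by lra.
  by rewrite !cosN.
have near : `|dcirc z' (act Q (y i1)) - dcirc z (act Q (y i1))| <= D0 + D01 + D1.
  rewrite (dcirc_act Q (y j)).
  have h1 := dcirc_dist (x j) z' (x i1) (act Q (y i1)); rewrite distrC in h1.
  have h2 : `|dcirc (x j) (x i1) - dcirc (y j) (y i1)| = D1.
    by rewrite /D1 /dist_diff (dcircC (x j)) (dcircC (y j)).
  have := ler_normD (dcirc z' (act Q (y i1)) - dcirc (x j) (x i1))
             (dcirc (x j) (x i1) - dcirc (y j) (y i1)).
  by rewrite addrA subrK h2; lra.
have := dcirc_triangle z' (x j) z; lra.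
Qed.

Lemma exists_le_average (A : {pred I}) (F : I -> R) : (0 < #|A|)%N ->
  exists2 i, i \in A & #|A|%:R * F i <= \sum_(i in A) F i.
Proof.
case/card_gt0P => i0 Ai0.
case: (@Order.TotalTheory.arg_minP _ _ _ i0 [in A] F Ai0) => i Ai imin.
exists i => //; rewrite mulr_natl -sumr_const.
by apply: ler_sum => j Aj; exact: imin.
Qed.

(** The first anchor has a row sum below average, and the second is a minimizer over the indices
    admissible for the first. These form at least a fraction 1/m of I, so passing from their average
    to the total costs a factor m. *)
Lemma d1_align x y (m : nat) : (0 < #|I|)%N ->
  (forall i0, #|I| <= m *
     #|[pred i | (pi / 4 <= dcirc (y i0) (y i) <= 3 * pi / 4)%R]|)%N ->
  exists Q : orthogonal_group R,
    #|I|%:R * d1 x (act_tuple Q y) <=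
    (3 + 4 * m%:R) * \sum_i \sum_j `|dist_diff x y i j|.
Proof.
move=> I0 hK; set L := \sum_i _; pose r i := \sum_j `|dist_diff x y i j|.
have r0 i : 0 <= r i by apply: sumr_ge0.
have [i0 _ hi0] := exists_le_average r I0.
rewrite -/L in hi0.
set K := [pred i | (pi / 4 <= dcirc (y i0) (y i) <= 3 * pi / 4)%R].
have IK : (#|I| <= m * #|K|)%N := hK i0.
have K0 : (0 < #|K|)%N by lia.
(* Summed over j, the bound of [align_anchors] charges the second anchor for its row sum and for
   #|I| copies of its discrepancy with i0; one minimization of g controls both. *)
pose g i := r i + #|I|%:R * `|dist_diff x y i0 i|.
have [i1 Ki1 hi1] := exists_le_average g K0.
have gK : \sum_(i in K) g i <= 2 * L.
  apply: (@le_trans _ _ (\sum_i g i)).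
    rewrite [leRHS](bigID [in K]) /= lerDl sumr_ge0 // => i _.
    by rewrite addr_ge0 ?mulr_ge0.
  by rewrite big_split /= -mulr_sumr -/(r i0) -/L; lra.
have gi1 : #|I|%:R * g i1 <= m%:R * (2 * L).
  apply: (@le_trans _ _ ((m * #|K|)%:R * g i1)).
    by apply: ler_wpM2r; rewrite ?ler_nat // addr_ge0 ?mulr_ge0.
  by rewrite natrM -mulrA ler_wpM2l //; lra.
have [Q hQ] := align_anchors x Ki1; exists Q.
have : d1 x (act_tuple Q y) <= 3 * r i0 + 2 * g i1.
  apply: (le_trans (ler_sum _ (fun j _ => hQ j))).
  rewrite !big_split /= -!mulr_sumr sumr_const -/(r i0) -/(r i1) /g.
  by rewrite -[_ *+ #|_|]mulr_natl; apply: le_of_eq; ring.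
move=> h; apply: (le_trans (ler_wpM2l (ler0n _ _) h)).
by lra.
Qed.

End Alignment.

(** * An approximate rearrangement inequality *)

Section Rearrangement.
Variable R : realType.

(* Layer cake over the level sets of A and B: on each level the constant c
   separates, up to e, the values of h on and off the level set of A. *)
Lemma approx_rearrangement (I : finType) (A B : I -> nat) (p : I -> I)
    (h : I -> R) (e : R) :
  bijective p -> (forall i, B i = A (p i)) ->
  (forall i j, (A i <= A j)%N -> h j <= h i + e) ->
  - e * \sum_i `|(B i)%:R - (A i)%:R| <= \sum_i h i * ((B i)%:R - (A i)%:R).
Proof.
(* M exceeds all values of A and B, so every integer involved is a sum over the same M layers. *)
move=> bp BA hA; pose M := (\sum_i (A i + B i))%N.
pose al m i : R := (m < A i)%N%:R; pose be m i : R := (m < B i)%N%:R.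
have lvl (k : nat) : (k <= M)%N -> k%:R = \sum_(m < M) (m < k)%N%:R :> R.
  move=> kM; rewrite -(subnKC kM) big_split_ord /= [X in _ + X]big1 ?addr0.
    rewrite (eq_bigr (fun=> 1)) ?sumr_const ?card_ord // => m _.
    by rewrite ltn_ord.
  by move=> m _; rewrite ltnNge leq_addr.
have AM i : (A i <= M)%N by rewrite /M (bigD1 i) //=; lia.
have BM i : (B i <= M)%N by rewrite /M (bigD1 i) //=; lia.
have al_mean m : \sum_i be m i = \sum_i al m i.
  rewrite [RHS](reindex p) /=; last exact/onW_bij.
  by apply: eq_bigr => i _; rewrite /be BA.
have -> : \sum_i h i * ((B i)%:R - (A i)%:R) =
    \sum_(m < M) \sum_i h i * (be m i - al m i).
  rewrite exchange_big; apply: eq_bigr => i _.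
  by rewrite (lvl _ (AM i)) (lvl _ (BM i)) -sumrB mulr_sumr.
(* For fixed i no two layer differences have opposite signs, so the absolute value passes inside the
   sum over layers. *)
have -> : \sum_i `|(B i)%:R - (A i)%:R| = \sum_(m < M) \sum_i `|be m i - al m i|.
  rewrite exchange_big; apply: eq_bigr => i _ /=.
  rewrite (lvl _ (AM i)) (lvl _ (BM i)) -sumrB /be /al.
  case/orP: (leq_total (A i) (B i)) => AB.
    rewrite ger0_norm; last first.
      apply: sumr_ge0 => m _; rewrite subr_ge0 ler_nat; case: ltnP => //= ?.
      by rewrite (_ : (m < B i)%N = true) //; lia.
    apply: eq_bigr => m _; rewrite ger0_norm // subr_ge0 ler_nat.
    by case: ltnP => //= ?; rewrite (_ : (m < B i)%N = true) //; lia.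
  rewrite ler0_norm; last first.
    apply: sumr_le0 => m _; rewrite subr_le0 ler_nat; case: ltnP => //= ?.
    by rewrite (_ : (m < A i)%N = true) //; lia.
  rewrite -sumrN; apply: eq_bigr => m _; rewrite ler0_norm // subr_le0 ler_nat.
  by case: ltnP => //= ?; rewrite (_ : (m < A i)%N = true) //; lia.
rewrite mulr_sumr; apply: ler_sum => m _.
(* c is the maximum of h on the level set of A or, if that set is empty, a number below every h i +
   e. *)
have [c hc] : exists c, forall i, if (m < A i)%N then h i <= c else c <= h i + e.
  have [[i0 Ai0]|none] := boolp.pselect (exists i, (m < A i)%N).
    case: (@Order.TotalTheory.arg_maxP _ _ _ i0 (fun i => m < A i)%N h Ai0).
    move=> i1 Ai1 imax.
    exists (h i1) => i; case: ifPn => Ai; first exact: imax.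
    by apply: hA; lia.
  exists (- \sum_i `|h i| + e) => i; case: ifPn => Ai; first by case: none; exists i.
  rewrite lerD2r (bigD1 i) //=; have := ler_norm (- h i); rewrite normrN.
  have : 0 <= \sum_(j | j != i) `|h j| by apply: sumr_ge0.
  by lra.
(* The level sets of A and B have the same cardinality, so subtracting c changes nothing. *)
have -> : \sum_i h i * (be m i - al m i) = \sum_i (h i - c) * (be m i - al m i).
  apply/eqP; rewrite -subr_eq0 -sumrB; apply/eqP.
  rewrite (eq_bigr (fun i => c * (be m i - al m i))); last by move=> i _; ring.
  by rewrite -mulr_sumr sumrB al_mean subrr mulr0.
rewrite mulr_sumr; apply: ler_sum => i _; have := hc i; have := hA i i (leqnn _).
rewrite /al /be.
case: ifP => _; case: ltnP => _ /= e0 hi;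
  by rewrite ?subrr ?subr0 ?sub0r ?normrN ?normr0 ?normr1 ?mulr0 //; lra.
Qed.

End Rearrangement.

(** * Roots of unity and their cyclic distance *)

Section Roots.
Variable R : realType.

Lemma arg_cis (t : R) : 0 <= t < 2 * pi -> arg (cis t) = t.
Proof. by move=> ht; apply: cis_inj; rewrite ?cis_arg // arg_ge0 arg_lt2pi. Qed.

(** With truncated subtraction, (i - j) + (j - i) is the absolute difference. Distances between N-th
    roots of unity are 2 pi / N times these integers, so the layer argument applies to them. *)
Definition cyc_dist (N i j : nat) : nat :=
  minn ((i - j) + (j - i)) (N - ((i - j) + (j - i))).

Lemma dcirc_unity_root (N : nat) (i j : 'I_N) :
  dcirc (unity_root R i) (unity_root R j) = 2 * pi / N%:R * (cyc_dist N i j)%:R.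
Proof.
have N0 : (0 < N)%N by have := ltn_ord i; lia.
have NR : 0 < N%:R :> R by rewrite ltr0n.
have pi0 := pi_gt0 R.
have k0 : 0 < 2 * pi / N%:R :> R by rewrite divr_gt0 ?mulr_gt0.
have argE (l : 'I_N) : arg (unity_root R l) = 2 * pi / N%:R * l%:R.
  rewrite arg_cis; first by rewrite mulrAC.
  have lN : l%:R < N%:R :> R by rewrite ltr_nat.
  rewrite divr_ge0 ?mulr_ge0 ?(ltW pi0) ?ler0n //=.
  by rewrite ltr_pdivrMr // ltr_pM2l ?mulr_gt0.
have dE : `|i%:R - j%:R| = ((i - j) + (j - i))%:R :> R.
  rewrite (_ : ((i - j) + (j - i) = maxn i j - minn i j)%N); last by lia.
  case/orP: (leq_total i j) => h.
    by rewrite (maxn_idPr h) (minn_idPl h) distrC ger0_norm ?subr_ge0 ?ler_nat // natrB.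
  by rewrite (maxn_idPl h) (minn_idPr h) ger0_norm ?subr_ge0 ?ler_nat // natrB.
rewrite /dcirc !argE -mulrBr normrM (gtr0_norm k0) dE.
set k := ((i - j) + (j - i))%N.
have kN : (k <= N)%N by rewrite /k; have := ltn_ord i; have := ltn_ord j; lia.
have -> : 2 * pi - 2 * pi / N%:R * k%:R = 2 * pi / N%:R * (N - k)%:R :> R.
  by rewrite natrB // mulrBr divfK ?gt_eqF.
by rewrite -minr_pMr ?ltW // /cyc_dist -/k -natr_min.
Qed.

(** Addition modulo N, written with one conditional subtraction to stay within linear arithmetic. *)
Definition rot_ord (N c k : nat) : nat :=
  (if k + c < N then k + c else k + c - N)%N.

Lemma rot_ord_lt (N : nat) (c k : 'I_N) : (rot_ord N c k < N)%N.
Proof.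
by rewrite /rot_ord; have := ltn_ord c; have := ltn_ord k; case: ifP; lia.
Qed.

Lemma PiP (I : finType) (N : nat) (x : I -> circle R) : Pi R I N x ->
  exists2 s : I -> 'I_N, bijective s & x = (fun i => unity_root R (s i)).
Proof.
case=> /boolp.choice[s sE] x_uniq; exists s; last exact/funext.
have /boolp.choice[r rE] : forall j, exists i, s i = j.
  move=> j; have [i [iE _]] := x_uniq j; exists i.
  by apply: (@unity_root_inj R); rewrite -sE.
exists r => // i; have [i' [_ iu]] := x_uniq (s i).
by rewrite -(iu (r (s i))) ?(iu i) // sE rE.
Qed.

(** The rotation by c = s i - s' i modulo N preserves cyclic distances and sends s' i to s i; p is
    this rotation read through the two labelings. *)
Lemma cyc_dist_reindex (I : finType) (N : nat) (s s' : I -> 'I_N) (i : I) :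
  bijective s -> bijective s' ->
  exists2 p : I -> I, bijective p &
    forall j, cyc_dist N (s' i) (s' j) = cyc_dist N (s i) (s (p j)).
Proof.
move=> [r sr rs] bs'; have hi := ltn_ord (s i); have hi' := ltn_ord (s' i).
pose c := if (s' i <= s i)%N then (s i - s' i)%N else (N + s i - s' i)%N.
have cN : (c < N)%N by rewrite /c; case: ifP; lia.
pose f (k : 'I_N) := Ordinal (rot_ord_lt (Ordinal cN) k).
have f_inj : injective f.
  move=> k k' /(congr1 val) /=; rewrite /rot_ord => h; apply/val_inj => /=; move: h.
  by have := ltn_ord k; have := ltn_ord k'; do 2 case: ifP; lia.
exists (r \o f \o s').
  by apply: bij_comp bs'; apply: bij_comp (injF_bij f_inj); exists s.
move=> j; rewrite /= rs /= /rot_ord /cyc_dist; have := ltn_ord (s' j).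
rewrite /c; do 2 case: ifP; lia.
Qed.

(** The roots N %/ 4 + l steps after [y i0], for l < N %/ 8, are at cyclic distance between N / 8
    and 3 N / 8, and N <= 16 (N %/ 8) once N >= 8. *)
Lemma card_anchors (I : finType) (N : nat) (y : I -> circle R) i0 :
  Pi R I N y -> (8 <= N)%N ->
  (N <= 16 * #|[pred i | (pi / 4 <= dcirc (y i0) (y i) <= 3 * pi / 4)%R]|)%N.
Proof.
move=> /PiP[s [r sr rs] ->] N8; set K := [pred i | _].
pose q (l : 'I_(N %/ 8)) := (N %/ 4 + l)%N.
have qN l : (q l < N)%N by rewrite /q; have := ltn_ord l; lia.
pose g l := r (Ordinal (rot_ord_lt (Ordinal (qN l)) (s i0))).
have g_inj : injective g.
  move=> l l' /(can_inj rs) /(congr1 val) /=; rewrite /rot_ord /q => h.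
  apply/val_inj => /=; move: h; have := ltn_ord (s i0).
  by have := ltn_ord l; have := ltn_ord l'; do 2 case: ifP; lia.
have gK : codom g \subset K.
  apply/fintype.subsetP => _ /codomP[l ->]; rewrite inE dcirc_unity_root rs /=.
  set k := cyc_dist _ _ _; have NR : 0 < N%:R :> R by rewrite ltr0n; lia.
  have [k1 k2] : (N <= 8 * k)%N /\ (8 * k <= 3 * N)%N.
    rewrite /k /cyc_dist /rot_ord /q; have := ltn_ord (s i0); have := ltn_ord l.
    by case: ifP; lia.
  have {}k1 : N%:R <= 8 * k%:R :> R by rewrite -natrM ler_nat.
  have {}k2 : 8 * k%:R <= 3 * N%:R :> R by rewrite -!natrM ler_nat.
  have pi0 := pi_gt0 R.
  have := ler_wpM2l (ltW pi0) k1; have := ler_wpM2l (ltW pi0) k2 => p2 p1.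
  have -> : 2 * pi / N%:R * k%:R = (2 * pi * k%:R) / N%:R :> R by rewrite mulrAC.
  by rewrite ler_pdivlMr // ler_pdivrMr //; apply/andP; split; lra.
have := subset_leq_card gK; rewrite card_codom // card_ord.
by move: #|K| => a; lia.
Qed.

End Roots.

(** * Bounding the Frobenius norm of the distance discrepancy *)

Section Energy.
Variable R : realType.

(** Cauchy-Schwarz over the #|I|^2 pairs. *)
Lemma sum_norm_le (I : finType) (a : I -> I -> R) :
  \sum_i \sum_j `|a i j| <= #|I|%:R * Num.sqrt (\sum_i \sum_j a i j ^+ 2).
Proof.
set V := \sum_i \sum_j a i j ^+ 2; set X := Num.sqrt V.
have V0 : 0 <= V by do 2 apply: sumr_ge0 => ? _; exact: sqr_ge0.
have XX : X ^+ 2 = V by rewrite sqr_sqrtr.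
have [X0|] := eqVneq X 0.
  rewrite X0 mulr0 big1 // => i _; rewrite big1 // => j _.
  apply/eqP; rewrite normr_eq0 -sqrf_eq0 eq_le sqr_ge0 andbT.
  apply: (@le_trans _ _ V); last by rewrite -XX X0 expr0n.
  rewrite /V (bigD1 i) //= (bigD1 j) //= -addrA lerDl addr_ge0 //.
    by apply: sumr_ge0 => ? _; exact: sqr_ge0.
  by do 2 apply: sumr_ge0 => ? _; exact: sqr_ge0.
move=> Xn0; have X0 : 0 < X by rewrite lt_neqAle eq_sym Xn0 sqrtr_ge0.
have [I0|] := eqVneq #|I| 0%N.
  by rewrite I0 mul0r big1 // => i; have := max_card (pred1 i); rewrite I0 card1.
rewrite -lt0n => I0; have N0 : 0 < #|I|%:R :> R by rewrite ltr0n.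
set N := #|I|%:R in N0 *.
(* AM-GM, tuned so that both terms sum to N X *)
have amgm i j : `|a i j| <= 2^-1 * (N / X * a i j ^+ 2 + X / N).
  have : 0 <= (N * `|a i j| - X) ^+ 2 / (N * X).
    by rewrite divr_ge0 ?sqr_ge0 // ltW // mulr_gt0.
  have -> : (N * `|a i j| - X) ^+ 2 / (N * X) =
      N / X * `|a i j| ^+ 2 + X / N - 2 * `|a i j|.
    by field; rewrite !gt_eqF.
  by rewrite real_normK ?num_real //; lra.
apply: (le_trans (ler_sum _ (fun i _ => ler_sum _ (fun j _ => amgm i j)))).
under eq_bigr do rewrite -mulr_sumr big_split /= -mulr_sumr sumr_const -mulr_natr.
rewrite -mulr_sumr big_split /= -mulr_sumr sumr_const -mulr_natr -/V -XX -/N.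
by apply: le_of_eq; field; rewrite !gt_eqF.
Qed.

(** In each row, h = f + cl d is nonincreasing in the distance up to e, so [approx_rearrangement]
    applies to it. The remaining term - cl sum d(y_i, y_j) D_ij equals (cl / 2) sum D_ij^2, because
    the rows of x and y have equal sums of squares. *)
Lemma signal_lower_bound (I : finType) (N : nat) (cl e : R)
    (f : circle R -> circle R -> R) (x y : I -> circle R) :
  Pi R I N x -> Pi R I N y ->
  (forall p q q', dcirc p q' <= dcirc p q ->
     cl * (dcirc p q - dcirc p q') - e <= f p q' - f p q) ->
  cl / 2 * (\sum_i \sum_j dist_diff x y i j ^+ 2)
    - e * \sum_i \sum_j `|dist_diff x y i j|
  <= \sum_i \sum_j f (y i) (y j) * dist_diff x y i j.
Proof.
move=> /PiP[s' bs' xE] /PiP[s bs yE] hl.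
rewrite !mulr_sumr -sumrB; apply: ler_sum => i _.
have [p bp hp] := cyc_dist_reindex i bs bs'.
have N0 : 0 < N%:R :> R by have := ltn_ord (s i); rewrite ltr0n; lia.
set k : R := 2 * pi / N%:R.
have k0 : 0 < k by rewrite divr_gt0 // mulr_gt0 // pi_gt0.
pose A j := cyc_dist N (s i) (s j); pose B j := cyc_dist N (s' i) (s' j).
have aE j : dcirc (y i) (y j) = k * (A j)%:R by rewrite yE dcirc_unity_root.
have bE j : dcirc (x i) (x j) = k * (B j)%:R by rewrite xE dcirc_unity_root.
pose h j := f (y i) (y j) + cl * dcirc (y i) (y j).
have hA j j' : (A j <= A j')%N -> h j' <= h j + e.
  move=> AA; have := hl (y i) (y j') (y j).
  by rewrite /h !aE ler_pM2l // ler_nat AA => /(_ isT); lra.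
have rear := approx_rearrangement bp (hp : forall j, B j = A (p j)) hA.
rewrite -(ler_pM2l k0) in rear.
have DE j : dist_diff x y i j = k * ((B j)%:R - (A j)%:R).
  by rewrite /dist_diff aE bE mulrBr.
have sq : \sum_j (dcirc (x i) (x j)) ^+ 2 = \sum_j (dcirc (y i) (y j)) ^+ 2.
  rewrite [RHS](reindex p) /=; last exact/onW_bij.
  by apply: eq_bigr => j _; rewrite aE bE /A -hp.
have -> : \sum_j f (y i) (y j) * dist_diff x y i j =
    k * (\sum_j h j * ((B j)%:R - (A j)%:R)) + cl / 2 * \sum_j dist_diff x y i j ^+ 2.
  have -> : cl / 2 * \sum_j dist_diff x y i j ^+ 2 =
      cl / 2 * \sum_j dist_diff x y i j ^+ 2 -
      cl / 2 * (\sum_j (dcirc (x i) (x j)) ^+ 2 - \sum_j (dcirc (y i) (y j)) ^+ 2).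
    by rewrite sq subrr mulr0 subr0.
  rewrite -sumrB -mulrBr -sumrB !mulr_sumr -big_split; apply: eq_bigr => j _ /=.
  by rewrite mulrCA -DE /dist_diff /h; field.
rewrite addrC lerD2r; apply: le_trans rear; rewrite mulrCA [k * _]mulr_sumr.
rewrite mulNr lerN2; apply: le_of_eq; congr (_ * _).
by apply: eq_bigr => j _; rewrite DE normrM (gtr0_norm k0).
Qed.

Lemma dinf_ge (I : finType) (x y : I -> circle R) i : dcirc (x i) (y i) <= dinf x y.
Proof.
exact: (@Order.TotalTheory.le_bigmax _ _ _ 0 (fun i => dcirc (x i) (y i))).
Qed.

(** Replacing f(u_i, u_j) by f(y_i, y_j) costs 2 (cL d_inf(u, y) + eps) per pair and the signal
    bound one more eps. Since sum |D_ij| <= #|I| X, what results is a quadratic inequality in X,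
    which is divided by X. *)
Lemma energy_bound (I : finType) (N n : nat) (cl cL ce W : R)
    (f : circle R -> circle R -> R) (x y u : I -> circle R) :
  let X := Num.sqrt (\sum_i \sum_j dist_diff x y i j ^+ 2) in
  0 < cl -> 0 <= cL -> biLipschitz cl cL ce n f ->
  Pi R I N x -> Pi R I N y ->
  0 <= #|I|%:R * (2 * cL * dinf u y + 3 * epsn ce n) + W ->
  \sum_i \sum_j f (u i) (u j) * dist_diff x y i j <= W * X ->
  X <= 2 / cl * (#|I|%:R * (2 * cL * dinf u y + 3 * epsn ce n) + W).
Proof.
move=> X cl0 cL0 [fC _ fL fl] Px Py W0 hW; set V := (X in Num.sqrt X) in X hW *.
have V0 : 0 <= V by do 2 apply: sumr_ge0 => ? _; exact: sqr_ge0.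
have XX : X ^+ 2 = V by rewrite sqr_sqrtr.
have X_ge0 : 0 <= X := sqrtr_ge0 _.
have [X0|Xn0] := eqVneq X 0; first by rewrite X0 mulr_ge0 // divr_ge0 // ltW.
have X0 : 0 < X by rewrite lt_neqAle eq_sym Xn0.
set e := epsn ce n in W0 fL fl *; set de := dinf u y in W0 *.
set L := \sum_i \sum_j `|dist_diff x y i j|.
have LX : L <= #|I|%:R * X := sum_norm_le _.
have := signal_lower_bound Px Py fl; rewrite -/V -XX -/L => sig.
have fuy i j : `|f (y i) (y j) - f (u i) (u j)| <= 2 * (cL * de + e).
  have := fL (u i) (u j) (y j); have := fL (y j) (u i) (y i).
  rewrite !(fC (y j)) (distrC _ (f (y i) (y j))) (distrC (f (u i) (u j))) => h1 h2.
  have := ler_distD (f (u i) (y j)) (f (y i) (y j)) (f (u i) (u j)).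
  have := ler_wpM2l cL0 (dinf_ge u y i); have := ler_wpM2l cL0 (dinf_ge u y j).
  by rewrite -/de; lra.
have yu : \sum_i \sum_j f (y i) (y j) * dist_diff x y i j <=
    \sum_i \sum_j f (u i) (u j) * dist_diff x y i j + 2 * (cL * de + e) * L.
  rewrite mulr_sumr -big_split; apply: ler_sum => i _ /=.
  rewrite mulr_sumr -big_split; apply: ler_sum => j _ /=.
  rewrite -lerBlDl -mulrBl (le_trans (ler_norm _)) // normrM.
  exact: ler_wpM2r.
have c0 : 0 <= 2 * (cL * de + e) + e.
  have de0 : 0 <= de := dinf_ge0 _ _.
  (* The Lipschitz condition at a repeated point yields 0 <= e. *)
  have := fL (cis 0) (cis 0) (cis 0); rewrite subrr normr0 dcircxx => e0.
  by have := mulr_ge0 cL0 de0; lra.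
have : cl / 2 * X ^+ 2 <= (#|I|%:R * (2 * cL * de + 3 * e) + W) * X.
  by have := ler_wpM2l c0 LX; lra.
rewrite expr2 mulrA ler_pM2r // => h.
have -> : X = 2 / cl * (cl / 2 * X) by field; rewrite gt_eqF.
by rewrite ler_wpM2l // divr_ge0 // ltW.
Qed.

Lemma sum_sym (n : nat) (g : 'I_n -> 'I_n -> R) :
  (forall i j, g i j = g j i) -> (forall i, g i i = 0) ->
  \sum_i \sum_j g i j = 2 * \sum_(i < n) \sum_(j < n | (i < j)%N) g i j.
Proof.
move=> gC g0; have swap : \sum_(i < n) \sum_(j < n | (i < j)%N) g i j =
    \sum_(i < n) \sum_(j < n | (j < i)%N) g i j.
  rewrite (exchange_big_dep xpredT) //=.
  by apply: eq_bigr => i _; apply: eq_bigr => j _; exact: gC.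
rewrite mulr_natl mulr2n {2}swap -big_split; apply: eq_bigr => i _ /=.
rewrite (bigID (fun j : 'I_n => (i < j)%N)) /=; congr (_ + _).
rewrite (bigD1 i) ?ltnn //= g0 add0r; apply: eq_bigl => j.
by rewrite -leqNgt [RHS]ltn_neqAle andbC.
Qed.

(** Extension by zero off S: the subGaussian condition is about full n by n coefficient matrices. *)
Definition extend (n : nat) (S : {set 'I_n})
    (a : {i : 'I_n | i \in S} -> {i : 'I_n | i \in S} -> R) (i j : 'I_n) : R :=
  if insub i is Some i' then if insub j is Some j' then a i' j' else 0 else 0.

Lemma sum_extend (n : nat) (S : {set 'I_n}) (g : 'I_n -> 'I_n -> R -> R)
    (a : {i : 'I_n | i \in S} -> {i : 'I_n | i \in S} -> R) :
  (forall i j, g i j 0 = 0) ->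
  \sum_i \sum_j g i j (extend a i j) = \sum_i \sum_j g (val i) (val j) (a i j).
Proof.
move=> g0.
have sumS (h : 'I_n -> R) : (forall i, i \notin S -> h i = 0) ->
    \sum_i h i = \sum_(i : {i : 'I_n | i \in S}) h (val i).
  move=> h0; rewrite (bigID [in S]) /= [X in _ + X]big1 ?addr0 //.
  exact: big_sub.
rewrite sumS => [|i iS]; last by rewrite big1 // => j _; rewrite /extend insubN.
apply: eq_bigr => i _; rewrite sumS => [|j jS].
  by apply: eq_bigr => j _; rewrite /extend !valK.
by rewrite /extend valK insubN.
Qed.

End Energy.

(** * Union bound for finitely many noise sums *)

Section UnionBound.
Variables (R : realType) (d : measure_display) (T : measurableType d).
Variable P : probability T R.

Lemma probability_union_bound (K : finType) (B : K -> set T) (q : R) :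
  (forall k, measurable (B k)) -> (forall k, (P (B k) <= q%:E)%E) ->
  measurable (\big[setU/set0]_k B k) /\
  (P (\big[setU/set0]_k B k) <= (#|K|%:R * q)%:E)%E.
Proof.
move=> mB Bq; split; first exact: bigsetU_measurable.
rewrite cardE -[index_enum K]enumT; elim: (enum K) => [|k s IH].
  by rewrite big_nil measure0 mul0r.
rewrite big_cons; apply: le_trans.
  by apply: measureU2 => //; exact: bigsetU_measurable.
by rewrite /= -natr1 mulrDl mul1r addrC EFinD leeD.
Qed.

Lemma noise_union_bound (n : nat) (E : 'I_n -> 'I_n -> {RV P >-> R})
    (K : finType) (B : K -> 'I_n -> 'I_n -> R) (t : R) :
  subGaussian1 E -> 0 <= t ->
  exists G : set T,
    [/\ measurable G, ((1 - #|K|%:R * expR (- (t ^+ 2) / 2))%:E <= P G)%E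
      & forall w, G w -> forall k,
          \sum_(i < n) \sum_(j < n | (i < j)%N) B k i j * E i j w <=
          t * Num.sqrt (\sum_(i < n) \sum_(j < n | (i < j)%N) B k i j ^+ 2)].
Proof.
move=> hsub t0.
pose Bad k := [set w | (\sum_(i < n) \sum_(j < n | (i < j)%N) B k i j * E i j w >
  t * Num.sqrt (\sum_(i < n) \sum_(j < n | (i < j)%N) B k i j ^+ 2))%R].
have mBad k : measurable (Bad k).
  rewrite /Bad; set c := t * _.
  (* Moving the condition i < j into the coefficient gives unrestricted sums, whose measurability is
     direct. *)
  pose S w := \sum_(i < n) \sum_(j < n) (if (i < j)%N then B k i j else 0) * E i j w.
  have SE w : \sum_(i < n) \sum_(j < n | (i < j)%N) B k i j * E i j w = S w.
    apply: eq_bigr => i _; rewrite big_mkcond; apply: eq_bigr => j _.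
    by case: ifP => //; rewrite mul0r.
  have mS : measurable_fun setT S.
    apply: measurable_sum => i; apply: measurable_sum => j.
    by apply: measurable_funM; [exact: measurable_cst | exact: measurable_funP].
  rewrite (_ : [set w | _] = setT `&` S @^-1` [set` `]c, +oo[]).
    by apply: mS => //; exact: measurable_itv.
  by apply/seteqP; split=> w /=; rewrite SE in_itv /= andbT => h; [split | case: h].
have PBad k : (P (Bad k) <= (expR (- (t ^+ 2) / 2))%:E)%E.
  apply: le_trans (hsub (\matrix_(i, j) B k i j) t t0).
  apply: le_of_eq; congr (P _).
  apply/funext => w; rewrite /Bad /=; congr (is_true (t * Num.sqrt _ < _)).
    by apply: eq_bigr => i _; apply: eq_bigr => j _; rewrite mxE.
  by apply: eq_bigr => i _; apply: eq_bigr => j _; rewrite mxE.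
have [mU PU] := probability_union_bound mBad PBad.
exists (~` \big[setU/set0]_k Bad k); split.
- exact: measurableC.
- rewrite probability_setC // EFinB leeB //.
- move=> w /= wG k; rewrite leNgt; apply/negP => bad; apply: wG.
  by rewrite (bigD1 k) //=; left.
Qed.

End UnionBound.

(** * Numerical estimates and assembly of the bounds *)

Section Main.
Variable R : realType.

(** From exp(- ln n) >= 1 - ln n, that is, ln n >= 1 - 1/n. *)
Lemma ln_ge_half (n : nat) : (4 <= n)%N -> 1 / 2 <= ln (n%:R : R).
Proof.
move=> n4; have n0 : 0 < n%:R :> R by rewrite ltr0n; lia.
have n4' : 4 <= n%:R :> R by rewrite ler_nat.
have := expR_ge1Dx (- ln (n%:R : R)); rewrite expRN lnK ?posrE // => h.
have : n%:R^-1 <= 4^-1 :> R by rewrite lef_pV2 ?posrE.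
by lra.
Qed.

(** At the level t with t^2 / 2 = n ln n each tail is n^(-n), and n^(n/4) n^2 < n^n. *)
Lemma card_tuples_expR_lt (n : nat) : (4 <= n)%N -> (4 %| n)%N ->
  ((n %/ 4) ^ (n %/ 4))%:R * expR (- (Num.sqrt (2 * (n%:R * ln n%:R)) ^+ 2) / 2)
    < 1 / n%:R ^+ 2 :> R.
Proof.
move=> n4 hn4; have n0 : 0 < n%:R :> R by rewrite ltr0n; lia.
have ln0 := ln_ge_half n4.
rewrite sqr_sqrtr; last by rewrite mulr_ge0 // mulr_ge0 //; lra.
have -> : - (2 * (n%:R * ln n%:R)) / 2 = - (n%:R * ln (n%:R : R)) by field.
rewrite expRN expRM_natl lnK ?posrE //.
rewrite ltr_pdivrMr ?exprn_gt0 // mulrAC ltr_pdivlMr ?exprn_gt0 //.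
rewrite mul1r -!natrX -natrM ltr_nat.
apply: (@leq_ltn_trans (n ^ (n %/ 4) * n ^ 2)).
  by rewrite leq_mul2r leq_exp2r ?leq_div // ?orbT //; lia.
by rewrite -expnD ltn_exp2l; lia.
Qed.

Lemma noise_level (n : nat) (ce : R) : 0 <= ce -> (4 <= n)%N ->
  (n %/ 4)%:R * epsn ce n <= ce * Num.sqrt (n%:R * ln n%:R).
Proof.
move=> ce0 n4; have n0 : 0 < n%:R :> R by rewrite ltr0n; lia.
have ln0 := ln_ge_half n4.
rewrite /epsn mulrCA ler_wpM2l //.
have -> : n%:R * ln n%:R = n%:R ^+ 2 * (ln n%:R / n%:R) :> R.
  by field; rewrite gt_eqF.
rewrite (sqrtrM _ (sqr_ge0 _)) sqrtr_sqr ger0_norm ?ler0n //.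
by rewrite ler_wpM2r ?sqrtr_ge0 // ler_nat leq_div.
Qed.

Lemma d1_le_pi (I : finType) (x y : I -> circle R) : d1 x y <= #|I|%:R * pi.
Proof.
rewrite mulr_natl -sumr_const; apply: ler_sum => i _; exact: dcirc_le_pi.
Qed.

Lemma d1_triangle (I : finType) (y x z : I -> circle R) : d1 x z <= d1 x y + d1 y z.
Proof. by rewrite -big_split; apply: ler_sum => i _; exact: dcirc_triangle. Qed.

Lemma d1C (I : finType) (x y : I -> circle R) : d1 x y = d1 y x.
Proof. by apply: eq_bigr => i _; exact: dcircC. Qed.

Lemma d1_act (I : finType) Q (x y : I -> circle R) :
  d1 (act_tuple Q x) (act_tuple Q y) = d1 x y.
Proof. by apply: eq_bigr => i _; exact: dcirc_act. Qed.

Lemma d1_le_dinf (I : finType) (x y : I -> circle R) : d1 x y <= #|I|%:R * dinf x y.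
Proof. by rewrite mulr_natl -sumr_const; apply: ler_sum => i _; exact: dinf_ge. Qed.

(** The factor #|I| lost in [sum_norm_le] is the one gained by averaging in [d1_align]; m = 16 comes
    from [card_anchors]. *)
Lemma d1_align_Pi (I : finType) (N : nat) (x y : I -> circle R) :
  Pi R I N y -> #|I| = N -> (8 <= N)%N ->
  exists Q : orthogonal_group R, d1 x (act_tuple Q y) <=
    67 * Num.sqrt (\sum_i \sum_j dist_diff x y i j ^+ 2).
Proof.
move=> Py IN N8; have I0 : (0 < #|I|)%N by rewrite IN; exact: leq_trans N8.
have [Q hQ] := @d1_align _ _ x y 16 I0
  (fun i0 => eq_ind_r (fun c => (c <= _)%N) (card_anchors i0 Py N8) IN).
exists Q; have I_gt0 : 0 < #|I|%:R :> R by rewrite ltr0n.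
rewrite -(ler_pM2l I_gt0) (le_trans hQ) // mulrCA.
have -> : 3 + 4 * 16%:R = 67 :> R by lra.
by rewrite ler_pM2l // sum_norm_le.
Qed.

(* Optimality of x makes the sum of the A_ij D_ij nonpositive. *)
Lemma noise_bound (n : nat) (S : {set 'I_n}) (A : 'M[R]_n) (E : 'I_n -> 'I_n -> R)
    (F : 'I_n -> 'I_n -> R) (x y : {i : 'I_n | i \in S} -> circle R) (t : R) :
  let a := fun i j => - dist_diff x y i j in
  0 <= t -> A^T = A -> (forall i j, F i j = F j i) ->
  (forall i j : 'I_n, (i < j)%N -> A i j = F i j + E i j) ->
  objective A x <= objective A y ->
  \sum_(i < n) \sum_(j < n | (i < j)%N) extend a i j * E i j <=
    t * Num.sqrt (\sum_(i < n) \sum_(j < n | (i < j)%N) extend a i j ^+ 2) ->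
  \sum_i \sum_j F (val i) (val j) * dist_diff x y i j <=
    2 * t * Num.sqrt (\sum_i \sum_j dist_diff x y i j ^+ 2).
Proof.
move=> a t0 AT FC AE opt hE.
have aC i j : extend a i j = extend a j i.
  rewrite /extend; case: insub => [i'|]; case: insub => [j'|] //.
  by rewrite /a /dist_diff (dcircC (x i')) (dcircC (y i')).
have a0 i : extend a i i = 0.
  rewrite /extend; case: insub => // i'.
  by rewrite /a /dist_diff !dcircxx subrr oppr0.
have AC i j : A i j = A j i by rewrite -[in LHS]AT mxE.
have sqE : \sum_i \sum_j dist_diff x y i j ^+ 2 =
    2 * \sum_(i < n) \sum_(j < n | (i < j)%N) extend a i j ^+ 2.
  rewrite -sum_sym; [|by move=> i j; rewrite aC | by move=> i; rewrite a0 expr0n].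
  rewrite (@sum_extend _ _ _ (fun _ _ z => z ^+ 2)); last by move=> *; rewrite expr0n.
  by apply: eq_bigr => i _; apply: eq_bigr => j _; rewrite sqrrN.
have noiseE : \sum_i \sum_j (A (val i) (val j) - F (val i) (val j)) * a i j =
    2 * \sum_(i < n) \sum_(j < n | (i < j)%N) extend a i j * E i j.
  rewrite -(@sum_extend _ _ _ (fun i j z => (A i j - F i j) * z)); last first.
    by move=> *; rewrite mulr0.
  rewrite sum_sym; first 1 last.
  - by move=> i j; rewrite aC AC FC.
  - by move=> i; rewrite a0 mulr0.
  congr (_ * _); apply: eq_bigr => i _; apply: eq_bigr => j ij.
  by rewrite AE // addrC addKr mulrC.
(* Write F = A - (A - F): the A part is the difference of objectives, and the rest is pure noise. *)
have -> : \sum_i \sum_j F (val i) (val j) * dist_diff x y i j =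
    objective A x - objective A y +
    \sum_i \sum_j (A (val i) (val j) - F (val i) (val j)) * a i j.
  rewrite /objective -sumrB -big_split; apply: eq_bigr => i _ /=.
  by rewrite -sumrB -big_split; apply: eq_bigr => j _ /=; rewrite /a /dist_diff; ring.
rewrite noiseE sqE; set V := \sum_(i < n) \sum_(j < n | _) _ ^+ 2 in hE *.
have V0 : 0 <= V by do 2 apply: sumr_ge0 => ? _; exact: sqr_ge0.
(* Full sums are twice the sums over i < j, so the noise is at most 2 t sqrt(V); the gain of sqrt(2)
   is given up. *)
have : t * Num.sqrt V <= t * Num.sqrt (2 * V).
  by apply: ler_wpM2l => //; apply: ler_wsqrtr; lra.
by rewrite -mulrA; lra.
Qed.

End Main.

Theorem proposition3p6 (R : realType) (cl cL ce : R)
    (hce : 0 <= ce) (hcl : 0 < cl) (hcL : cl <= cL) :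
  exists C : R,
  forall (n : nat) (hn : (0 < n)%N) (hn4 : (4 %| n)%N)
    (d : measure_display) (T : measurableType d) (P : probability T R)
    (xs : 'I_n -> circle R) (f : circle R -> circle R -> R)
    (hf : biLipschitz cl cL ce n f)
    (E : 'I_n -> 'I_n -> {RV P >-> R})
    (hcentered : forall i j : 'I_n, (i < j)%N -> centered (E i j))
    (hindep : mutually_independent
       [set p : 'I_n * 'I_n | (p.1 < p.2)%N]%SET (fun p => E p.1 p.2))
    (hsub : subGaussian1 E)
    (A : T -> 'M[R]_n) (hA : observation xs f E A)
    (S : {set 'I_n}) (hS : #|S| = (n %/ 4)%N)
    (xhat : T -> {i : 'I_n | i \in S} -> circle R)
    (hxhat : forall w,
       argmin (Pi R {i : 'I_n | i \in S} (n %/ 4)) (objective (A w)) (xhat w)),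
  exists G : set T,
    [/\ measurable G,
        ((1 - 1 / n%:R ^+ 2)%:E < P G)%E
      & forall w, G w -> exists Q : orthogonal_group R,
          d1 (xhat w) (act_tuple Q (restr xs)) <=
          C * (n%:R * dinf_Pi (n %/ 4) (restr (S := S) xs)
               + Num.sqrt (n%:R * ln n%:R))].
Proof.
have cL0 : 0 <= cL by lra.
(* The factor 67 comes from the alignment and 2 / cl from the energy bound, where 2 cL and 3 ce
   weigh d_inf and eps and 4 comes from 2 t <= 4 r. The final 1 pays for passing from y to x*_S, and
   7 pi covers N < 8. *)
pose C1 := 67 * (2 / cl * (2 * cL + (3 * ce + 4))) + 1.
exists (C1 + 7 * pi) => n hn hn4 d T P xs f hf E _ _ hsub A hA S hS xhat hxhat.
have n4 : (4 <= n)%N by lia.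
have n1 : 1 <= n%:R :> R by rewrite ler1n.
set N := (n %/ 4)%N in hS hxhat *.
pose I : finType := ({i : 'I_n | i \in S} : finType).
have IN : #|I| = N by rewrite card_sig -hS; apply: eq_card => i; rewrite inE.
set u := restr xs.
have [y Py [duy _]] := dinf_Pi_attained u (Pi_neq0 R IN).
rewrite duy; set de := dinf u y; have de0 : 0 <= de := dinf_ge0 u y.
set r := Num.sqrt (n%:R * ln n%:R).
have r1 : 1 <= r.
  rewrite -[1](@sqrtr1 R); apply: ler_wsqrtr.
  have := ln_ge_half R n4; have n4' : 4 <= n%:R :> R by rewrite ler_nat.
  by nra.
have r0 : 0 <= r := sqrtr_ge0 _.
pose t := Num.sqrt (2 * (n%:R * ln n%:R) : R).
have t0 : 0 <= t := sqrtr_ge0 _.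
have tr : t <= 2 * r.
  have -> : 2 * r = Num.sqrt (4 * (n%:R * ln n%:R)).
    have -> : 4 = 2 ^+ 2 :> R by rewrite expr2; lra.
    by rewrite sqrtrM ?sqr_ge0 // sqrtr_sqr ger0_norm.
  apply: ler_wsqrtr; have : 0 <= n%:R * ln (n%:R : R).
    by rewrite mulr_ge0 //; have := ln_ge_half R n4; lra.
  by lra.
(* The estimator is random, so the good event must serve all candidates at once. All N^N maps into
   the roots are taken, a finite type containing [Pi]. *)
pose tup (s : {ffun I -> 'I_N}) i := unity_root R (s i).
pose B s := extend (fun i j => - dist_diff (tup s) y i j).
have [G [mG PG hG]] := noise_union_bound B hsub t0.
exists G; split => //.
  apply: lt_le_trans PG; rewrite lte_fin ltrD2l ltrN2.
  by rewrite card_ffun card_ord IN; exact: card_tuples_expR_lt.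
move=> w Gw; have [Px xopt] := hxhat w; set x := xhat w in Px xopt *.
have C1_ge0 : 0 <= C1.
  by rewrite addr_ge0 // mulr_ge0 // mulr_ge0 ?divr_ge0 ?(ltW hcl) // addr_ge0 //; lra.
have nde0 : 0 <= n%:R * de by rewrite mulr_ge0.
have nder0 : 0 <= n%:R * de + r by exact: addr_ge0.
have pi0 := pi_gt0 R.
(* Below 8 points anchors may be missing, but d_1 <= 7 pi for any Q and r >= 1. *)
have [N8|N8] := leqP 8 N; last first.
  have [Q _] := @orthogonal_angle R 0 1 (expr1n _ _); exists Q.
  apply: (le_trans (d1_le_pi _ _)); rewrite IN.
  have : N%:R * pi <= 7 * pi :> R by rewrite ler_pM2r // ler_nat -ltnS.
  have : 7 * pi * 1 <= 7 * pi * (n%:R * de + r) by rewrite ler_pM2l ?mulr_gt0 //; lra.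
  have : 0 <= C1 * (n%:R * de + r) by exact: mulr_ge0.
  by rewrite (mulrDl C1); lra.
have [AT _ AE] := hA w; have [fC _ fL _] := hf.
pose X := Num.sqrt (\sum_i \sum_j dist_diff x y i j ^+ 2).
have energy : X <= 2 / cl * ((2 * cL + (3 * ce + 4)) * (n%:R * de + r)).
  have [s _ xE] := PiP Px.
  have noise : \sum_i \sum_j f (u i) (u j) * dist_diff x y i j <= 2 * t * X.
    apply: (noise_bound t0 AT (fun i j => fC (xs i) (xs j)) AE (xopt _ Py)).
    have := hG w Gw [ffun i => s i]; rewrite /B.
    have -> : tup [ffun i => s i] = x.
      by rewrite xE; apply/funext => i; rewrite /tup ffunE.
    by [].
  have W0 : 0 <= #|I|%:R * (2 * cL * de + 3 * epsn ce n) + 2 * t.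
    have e0 : 0 <= epsn ce n by rewrite mulr_ge0 ?sqrtr_ge0.
    by rewrite addr_ge0 ?mulr_ge0 // addr_ge0 ?mulr_ge0.
  apply: (le_trans (energy_bound hcl cL0 hf Px Py W0 noise)).
  rewrite ler_wpM2l ?divr_ge0 ?(ltW hcl) // IN -/de.
  have Ne : N%:R * epsn ce n <= ce * r := noise_level hce n4.
  have Nn : N%:R * de <= n%:R * de by rewrite ler_wpM2r // ler_nat leq_div.
  have := ler_wpM2l cL0 Nn.
  have : 0 <= cL * r by rewrite mulr_ge0.
  have : 0 <= ce * (n%:R * de) by rewrite mulr_ge0.
  by lra.
have [Q xQy] := d1_align_Pi x Py IN N8; exists Q; rewrite -/X in xQy.
have yu : d1 y u <= n%:R * de.
  rewrite d1C (le_trans (d1_le_dinf _ _)) // -/de ler_wpM2r //.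
  by rewrite ler_nat IN leq_div.
have := d1_triangle (act_tuple Q y) x (act_tuple Q u); rewrite d1_act.
have : 0 <= 7 * pi * (n%:R * de + r).
  by rewrite mulr_ge0 // mulr_ge0 // ltW.
by rewrite (mulrDl C1) /C1; lra.
Qed.
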